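(* Let $a_1,a_2>0$, $\beta=a_1+a_2$, $0<p<q$, $0<\ell<u<+\infty$, and $f:\mathbb{R}_+^2\to\mathbb{R}_+$, $f(x)=x_1^{a_1}x_2^{a_2}$. Let $X=\{x\in\mathbb{R}_+^2:\ell\le f(x)\le u\}$ and $W_{12}=\{x\in\mathbb{R}^2_+: p x_1\le x_2\le q x_1\}$. Let $z_0,\lambda,\zeta,d_1,d_2$ and $Y$ be as defined in the context. Then the lower envelope of $f$ over $X\cap W_{12}$ is $$E_L(f,X\cap W_{12})=\{(x,z)\in Y\times\mathbb{R}:\ z\ge f_\ell(x),\ z\ge \ell\},$$ where $f_\ell(x)=\lambda(d_2x_1-d_1x_2)^{\beta}$ if $\beta\ge 1$, and $f_\ell(x)=\zeta(d_2x_1-d_1x_2)+z_0$ if $\beta\le 1$.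
   Context: $\mathbb{R}_+$ denotes the nonnegative reals. For $T\subseteq\mathbb{R}^n$ and a real-valued function $f$ defined on $T$, the epigraph of $f$ in $T$ is $\mathrm{epi}(f,T)=\{(x,z)\in T\times\mathbb{R}: z\ge f(x)\}$, and the lower envelope $E_L(f,T)$ is the convex hull of $\mathrm{epi}(f,T)$. Constants: $d_1=q^{-a_2/(a_1+a_2)}-p^{-a_2/(a_1+a_2)}$, $d_2=q^{a_1/(a_1+a_2)}-p^{a_1/(a_1+a_2)}$, $\lambda=\dfrac{p^{a_2}}{(d_2-d_1p)^{a_1+a_2}}$, $z_0=\dfrac{u^{1/\beta}\ell-\ell^{1/\beta}u}{u^{1/\beta}-\ell^{1/\beta}}$, $\zeta=\lambda^{1/\beta}\dfrac{u-\ell}{u^{1/\beta}-\ell^{1/\beta}}$. Set: $Y=\{x\in\mathbb{R}_+^2:\ p x_1\le x_2\le q x_1,\ x_1^{a_1}x_2^{a_2}\ge \ell,\ d_2x_1-d_1x_2\le (u/\lambda)^{1/\beta}\}$. *)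

(* Defs.v *)
From mathcomp Require Import all_boot all_order all_algebra.
From mathcomp Require Import classical_sets reals exp convex.

Set Implicit Arguments.
Unset Strict Implicit.
Unset Printing Implicit Defensive.

Import Order.TTheory GRing.Theory Num.Theory.

Local Open Scope classical_set_scope.
Local Open Scope ring_scope.

Definition convex_hull (R : numDomainType) (M : lmodType R) (A : set M) :
  set M := smallest (@convex_set R M) A.

(* In 'rV[R]_n * R^o, the second factor is R^o so that the product carries its
   R-module structure.  A function on T is represented by a total function, of
   which epi only uses the values on T. *)
Definition epi (R : realType) (n : nat) (f : 'rV[R]_n -> R)
    (T : set 'rV[R]_n) : set ('rV[R]_n * R^o) :=
  [set w | T w.1 /\ f w.1 <= w.2].

Definition lower_envelope (R : realType) (n : nat) (f : 'rV[R]_n -> R)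
    (T : set 'rV[R]_n) : set ('rV[R]_n * R^o) :=
  convex_hull (epi f T).

Definition orthant (R : realType) (n : nat) : set 'rV[R]_n :=
  [set x | forall i, 0 <= x 0 i].

(* Coordinates are numbered from 0: x_1 is x 0 0 and x_2 is x 0 1.  This is the
   intended function on orthant R 2 only: there 0 `^ a = 0 for a > 0, whereas
   powR returns junk on negative bases. *)
Definition monomial (R : realType) (a1 a2 : R) (x : 'rV[R]_2) : R :=
  x 0 0 `^ a1 * x 0 1 `^ a2.

Definition levelX (R : realType) (a1 a2 l u : R) : set 'rV[R]_2 :=
  [set x | orthant x /\ l <= monomial a1 a2 x <= u].

Definition wedge (R : realType) (p q : R) : set 'rV[R]_2 :=
  [set x | orthant x /\ p * x 0 0 <= x 0 1 <= q * x 0 0].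

Section constants.
Context {R : realType}.
Variables a1 a2 p q l u : R.

Local Notation beta := (a1 + a2).

Definition d1 : R := q `^ (- a2 / beta) - p `^ (- a2 / beta).

Definition d2 : R := q `^ (a1 / beta) - p `^ (a1 / beta).

(* For 0 < p < q we have d1 < 0 < d2, so the base d2 - d1 * p is positive. *)
Definition lambda : R := p `^ a2 / (d2 - d1 * p) `^ beta.

Definition z0 : R :=
  (u `^ beta^-1 * l - l `^ beta^-1 * u) / (u `^ beta^-1 - l `^ beta^-1).

Definition zeta : R :=
  lambda `^ beta^-1 * ((u - l) / (u `^ beta^-1 - l `^ beta^-1)).

Definition regionY : set 'rV[R]_2 :=
  [set x | [/\ orthant x, p * x 0 0 <= x 0 1 <= q * x 0 0,
               l <= x 0 0 `^ a1 * x 0 1 `^ a2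
             & d2 * x 0 0 - d1 * x 0 1 <= (u / lambda) `^ beta^-1]].

(* fl_ge1 and fl_le1 are f_l for beta >= 1 and beta <= 1; they agree at beta = 1,
   where zeta = lambda and z0 = 0.  On the orthant the base of the power is
   nonnegative. *)
Definition fl_ge1 (x : 'rV[R]_2) : R :=
  lambda * (d2 * x 0 0 - d1 * x 0 1) `^ beta.

Definition fl_le1 (x : 'rV[R]_2) : R :=
  zeta * (d2 * x 0 0 - d1 * x 0 1) + z0.

End constants.

(* Main.v *)
(* Put beta = a1 + a2 and let g = f^(1/beta), which is homogeneous of degree 1
   and concave on the orthant.  The linear form
   M x = lambda^(1/beta) (d2 x1 - d1 x2) is the one that agrees with g on the two
   boundary rays of the wedge, so M <= g, and Y is the part of the wedge where
   g >= L and M <= U, for L = l^(1/beta) and U = u^(1/beta).  Moreover f_l is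
   phi (M x), where phi is the convex envelope on [L, U] of t |-> t^beta: the
   power itself if beta >= 1, its chord if beta <= 1.  Hence the right-hand side
   is convex and contains the epigraph.  Conversely, a point x of Y with M x >= L
   is a convex combination of the two points of the boundary rays with the same
   value of M, where f is M^beta, and if beta <= 1 each of these is moved along
   its ray to M = L and M = U.  If M x < L <= g x then x lies on a segment with
   both ends on the curve g = L, where f = l. *)
Require Import Defs.
From mathcomp Require Import all_boot all_order all_algebra.
From mathcomp Require Import ring.
From mathcomp Require Import classical_sets reals exp convex.
From mathcomp Require Import interval_inference topology normedtype hoelder.

Set Implicit Arguments.
Unset Strict Implicit.
Unset Printing Implicit Defensive.

Import Order.TTheory GRing.Theory Num.Theory.
Import numFieldNormedType.Exports.

Local Open Scope classical_set_scope.
Local Open Scope ring_scope.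

(** * Concavity of the weighted geometric mean and of powers *)

Lemma weighted_AMGM (R : realType) (a b x y : R) :
  0 < a -> 0 < b -> a + b = 1 -> 0 <= x -> 0 <= y ->
  x `^ a * y `^ b <= a * x + b * y.
Proof.
move=> a0 b0 ab x0 y0.
have := @conjugate_powR _ (x `^ a) (y `^ b) a^-1 b^-1.
rewrite !powR_ge0 !invr_gt0 !invrK -!powRrM !mulfV ?gt_eqF// !powRr1//.
by rewrite (mulrC a) (mulrC b); apply.
Qed.

(** After division by the right-hand side, weighted AM-GM bounds each of the two normalised terms,
    and the bounds add up to [a + b = 1]. A vanishing coordinate sum is split off because it cannot
    be a divisor. *)
Lemma powR2_superadditive (R : realType) (a b x1 x2 y1 y2 : R) :
  0 < a -> 0 < b -> a + b = 1 ->
  0 <= x1 -> 0 <= x2 -> 0 <= y1 -> 0 <= y2 ->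
  x1 `^ a * x2 `^ b + y1 `^ a * y2 `^ b <= (x1 + y1) `^ a * (x2 + y2) `^ b.
Proof.
move=> a0 b0 ab x10 x20 y10 y20.
have neq0 (z w : R) : 0 <= z -> 0 <= w -> z + w != 0 -> 0 < z + w.
  by move=> *; rewrite lt0r addr_ge0// andbT.
have [/eqP|s1] := eqVneq (x1 + y1) 0.
  rewrite paddr_eq0// => /andP[/eqP -> /eqP ->].
  by rewrite powR0 ?gt_eqF// !mul0r addr0 mulr_ge0 ?powR_ge0.
have [/eqP|s2] := eqVneq (x2 + y2) 0.
  rewrite paddr_eq0// => /andP[/eqP -> /eqP ->].
  by rewrite (@powR0 _ b) ?gt_eqF// !mulr0 addr0 mulr_ge0 ?powR_ge0.
have {}s1 := neq0 _ _ x10 y10 s1; have {}s2 := neq0 _ _ x20 y20 s2.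
have E (z1 z2 : R) : 0 <= z1 -> 0 <= z2 -> z1 `^ a * z2 `^ b =
    ((z1 / (x1 + y1)) `^ a * (z2 / (x2 + y2)) `^ b) *
    ((x1 + y1) `^ a * (x2 + y2) `^ b).
  move=> z10 z20; rewrite mulrACA -!powRM ?divr_ge0 ?(ltW s1) ?(ltW s2)//.
  by rewrite !divfK ?gt_eqF.
rewrite (E x1 x2)// (E y1 y2)// -mulrDl -[leRHS]mul1r.
apply: ler_wpM2r; first by rewrite mulr_ge0 ?powR_ge0.
have X := weighted_AMGM a0 b0 ab (divr_ge0 x10 (ltW s1)) (divr_ge0 x20 (ltW s2)).
have Y := weighted_AMGM a0 b0 ab (divr_ge0 y10 (ltW s1)) (divr_ge0 y20 (ltW s2)).
apply: (le_trans (lerD X Y)); rewrite le_eqVlt -ab; apply/orP; left; apply/eqP.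
by field; rewrite !gt_eqF.
Qed.

Lemma powR2_homogeneous (R : realType) (a b k x y : R) :
  a + b = 1 -> 0 <= k -> 0 <= x -> 0 <= y ->
  (k * x) `^ a * (k * y) `^ b = k * (x `^ a * y `^ b).
Proof.
move=> ab k0 x0 y0; rewrite !powRM// mulrACA -powRD ?ab ?powRr1//.
by rewrite oner_eq0.
Qed.

(** Homogeneity moves the weights inside the powers, where superadditivity applies. *)
Lemma powR2_concave (R : realType) (a b t x1 x2 y1 y2 : R) :
  0 < a -> 0 < b -> a + b = 1 -> 0 <= t <= 1 ->
  0 <= x1 -> 0 <= x2 -> 0 <= y1 -> 0 <= y2 ->
  t * (x1 `^ a * x2 `^ b) + (1 - t) * (y1 `^ a * y2 `^ b) <=
  (t * x1 + (1 - t) * y1) `^ a * (t * x2 + (1 - t) * y2) `^ b.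
Proof.
move=> a0 b0 ab /andP[t0 t1] x10 x20 y10 y20.
have t1' : 0 <= 1 - t by rewrite subr_ge0.
rewrite -!powR2_homogeneous//; apply: powR2_superadditive => //;
  exact: mulr_ge0.
Qed.

Lemma powR_convex (R : realType) (b t x y : R) :
  1 <= b -> 0 <= t <= 1 -> 0 <= x -> 0 <= y ->
  (t * x + (1 - t) * y) `^ b <= t * x `^ b + (1 - t) * y `^ b.
Proof.
move=> b1 /andP[t0 t1] x0 y0.
have := convex_powR b1 (Itv01 t0 t1) (x := x) (y := y).
by apply; rewrite inE/= in_itv/= andbT.
Qed.

(** Convexity of the power [b^-1] at the points [x]^ b[and]y [^ b], raised to the power [b]. *)
Lemma powR_concave (R : realType) (b t x y : R) :
  0 < b <= 1 -> 0 <= t <= 1 -> 0 <= x -> 0 <= y ->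
  t * x `^ b + (1 - t) * y `^ b <= (t * x + (1 - t) * y) `^ b.
Proof.
move=> /andP[b0 b1] t01 x0 y0; have /andP[t0 t1] := t01.
have t1' : 0 <= 1 - t by rewrite subr_ge0.
have ib1 : 1 <= b^-1 by rewrite invr_ge1 ?unitfE ?gt_eqF.
have := powR_convex ib1 t01 (powR_ge0 x b) (powR_ge0 y b).
rewrite -!powRrM mulfV ?gt_eqF// !powRr1// => /(ge0_ler_powR (ltW b0)).
rewrite -powRrM mulVf ?gt_eqF// powRr1 ?addr_ge0 ?mulr_ge0 ?powR_ge0//.
by apply; rewrite nnegrE ?powR_ge0// addr_ge0 ?mulr_ge0.
Qed.

(** * Combinations in convex hulls, and an intermediate value on a segment *)

Lemma hull_comb (R : realType) (M : lmodType R) (A : set M) (t : R) (x y : M) :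
  0 <= t <= 1 -> convex_hull A x -> convex_hull A y ->
  convex_hull A (t *: x + (1 - t) *: y).
Proof.
move=> /andP[t0 t1] Ax Ay C [cC AC].
have := cC x y (Itv01 t0 t1); rewrite !inE; apply.
- exact: Ax.
- exact: Ay.
Qed.

Lemma pair_comb (R : pzRingType) (V : lmodType R) (k k' z z' : R) (x x' : V) :
  k *: (x, z : R^o) + k' *: (x', z' : R^o) =
  (k *: x + k' *: x', k * z + k' * z' : R^o).
Proof. by []. Qed.

(** The intermediate value theorem is applied to [ln (g t)], a sum of logarithms. Since [r < 1] and
    the end at [t = 0] has positive coordinates, the logarithms have positive arguments on all of
    [[0, r]], even if the end at [t = 1] lies on an axis. *)
Lemma powR2_IVT (R : realType) (a b v r x1 x2 y1 y2 : R) :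
  0 <= r < 1 -> 0 < v -> 0 <= x1 -> 0 <= x2 -> 0 < y1 -> 0 < y2 ->
  let g (t : R) := (t * x1 + (1 - t) * y1) `^ a * (t * x2 + (1 - t) * y2) `^ b in
  g 0 <= v <= g r -> exists2 t, 0 <= t <= r & g t = v.
Proof.
move=> /andP[r0 r1] v0 x10 x20 y10 y20 g gv.
have pos (x y t : R) : 0 <= x -> 0 < y -> 0 <= t <= r -> 0 < t * x + (1 - t) * y.
  move=> x0 y0 /andP[t0 tr].
  by rewrite ltr_wpDl ?mulr_ge0 ?mulr_gt0 ?subr_gt0 ?(le_lt_trans tr).
pose h (t : R) := a * ln (t * x1 + (1 - t) * y1) + b * ln (t * x2 + (1 - t) * y2).
have gh (t : R) : 0 <= t <= r -> ln (g t) = h t.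
  by move=> tr; rewrite /g lnM ?posrE ?powR_gt0 ?pos// !ln_powR.
have g0 (t : R) : 0 <= t <= r -> 0 < g t.
  by move=> tr; rewrite mulr_gt0 ?powR_gt0 ?pos.
have lc (x y t : R) : 0 <= x -> 0 < y -> 0 <= t <= r ->
    {for t, continuous (fun s : R => ln (s * x + (1 - s) * y))}.
  move=> x0 y0 tr; apply: continuous_comp; last exact/continuous_ln/pos.
  apply: cvgD; apply: cvgM; try exact: cvg_cst; first exact: cvg_id.
  by apply: cvgB; [exact: cvg_cst|exact: cvg_id].
have [||t tr ht] := @IVT _ h 0 r (ln v) r0.
- apply: continuous_in_subspaceT => t; rewrite inE/= in_itv/= => tr.
  by apply: cvgD; apply: cvgM; try exact: cvg_cst; exact: lc.
- have zr : 0 <= (0 : R) <= r by rewrite lexx.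
  have rr : 0 <= r <= r by rewrite r0 lexx.
  have /andP[gv1 gv2] := gv.
  rewrite -!gh// ge_min le_max !ler_ln ?posrE ?g0//.
  by rewrite gv1 gv2 orbT.
- exists t; first by move: tr; rewrite in_itv.
  move: tr; rewrite in_itv/= => tr.
  by apply: ln_inj; rewrite ?posrE ?g0// gh.
Qed.

(** * Conic coordinates on the wedge *)

Section wedge_rays.
Context {R : realType}.
Variables a b p q : R.
Hypotheses (a0 : 0 < a) (b0 : 0 < b) (ab : a + b = 1).
Hypotheses (p0 : 0 < p) (pq : p < q).

Let q0 : 0 < q. Proof. exact: lt_trans pq. Qed.

Definition geo (x : 'rV[R]_2) : R := x 0 0 `^ a * x 0 1 `^ b.

(* Conic coordinates of the wedge: the generators of its two boundary rays are
   normalised by geo = 1. *)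
Definition ray (s t : R) : 'rV[R]_2 :=
  \row_(i < 2) (if i == 0 then s / p `^ b + t / q `^ b
                else s / p `^ b * p + t / q `^ b * q).

Lemma ray_comb (k k' s t s' t' : R) :
  ray (k * s + k' * s') (k * t + k' * t') = k *: ray s t + k' *: ray s' t'.
Proof. by apply/rowP => i; rewrite !mxE; case: ifP => _; ring. Qed.

Lemma wedge_ray (s t : R) : 0 <= s -> 0 <= t -> wedge p q (ray s t).
Proof.
move=> s0 t0; rewrite /wedge /orthant/= !mxE/=.
have S : 0 <= s / p `^ b by rewrite divr_ge0 ?powR_ge0.
have T : 0 <= t / q `^ b by rewrite divr_ge0 ?powR_ge0.
split.
  move=> i; rewrite mxE; case: ifP => _; apply: addr_ge0 => //;
  by apply: mulr_ge0 => //; exact: ltW.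
have Tpq := ler_wpM2l T (ltW pq); have Spq := ler_wpM2l S (ltW pq).
by rewrite !mulrDr !(mulrC p) !(mulrC q) lerD2l lerD2r Tpq Spq.
Qed.

Lemma wedgeP x : wedge p q x ->
  exists s t : R, [/\ 0 <= s, 0 <= t & x = ray s t].
Proof.
move=> [_ /andP[px xq]]; have pq0 : 0 < q - p by rewrite subr_gt0.
(* The solution of the 2 by 2 linear system [x = ray s t], by Cramer's rule. *)
exists (p `^ b * ((q * x 0 0 - x 0 1) / (q - p))).
exists (q `^ b * ((x 0 1 - p * x 0 0) / (q - p))).
split; [by rewrite mulr_ge0 ?powR_ge0 ?divr_ge0 ?subr_ge0 ?(ltW pq)..|].
have pb := powR_gt0 b p0; have qb := powR_gt0 b q0.
apply/rowP; case=> [[|[|n]] i2] //; rewrite !mxE/=.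
- rewrite (_ : Ordinal i2 = 0); last exact/val_inj.
  by field; rewrite !gt_eqF.
- rewrite (_ : Ordinal i2 = 1); last exact/val_inj.
  by field; rewrite !gt_eqF.
Qed.

Let geo_gen (s r : R) : 0 <= s -> 0 < r ->
  (s / r `^ b) `^ a * (s / r `^ b * r) `^ b = s.
Proof.
move=> s0 r0; have rb := powR_gt0 b r0.
rewrite -[X in X `^ a]mulr1 powR2_homogeneous ?divr_ge0 ?powR_ge0 ?(ltW r0)//.
by rewrite powR1 mul1r divfK// gt_eqF.
Qed.

Lemma geo_rayl (s : R) : 0 <= s -> geo (ray s 0) = s.
Proof. by move=> s0; rewrite /geo !mxE/= !mul0r !addr0 geo_gen. Qed.

Lemma geo_rayr (t : R) : 0 <= t -> geo (ray 0 t) = t.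
Proof. by move=> t0; rewrite /geo !mxE/= !mul0r !add0r geo_gen. Qed.

Lemma geo_concave (k s t s' t' : R) :
  0 <= k <= 1 -> 0 <= s -> 0 <= t -> 0 <= s' -> 0 <= t' ->
  k * geo (ray s t) + (1 - k) * geo (ray s' t') <=
  geo (ray (k * s + (1 - k) * s') (k * t + (1 - k) * t')).
Proof.
move=> k01 s0 t0 s0' t0'; rewrite ray_comb /geo.
have [W _] := wedge_ray s0 t0; have [W' _] := wedge_ray s0' t0'.
by have := powR2_concave a0 b0 ab k01 (W 0) (W 1) (W' 0) (W' 1); rewrite !mxE.
Qed.

(** Superadditivity for the splitting of [ray s t] into [ray s 0] and [ray 0 t]. In these
    coordinates [s + t] is the linear form M, so this is M <= g. *)
Lemma geo_ray_ge (s t : R) : 0 <= s -> 0 <= t -> s + t <= geo (ray s t).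
Proof.
move=> s0 t0.
have [W _] := wedge_ray s0 (lexx 0); have [W' _] := wedge_ray (lexx 0) t0.
have := powR2_superadditive a0 b0 ab (W 0) (W 1) (W' 0) (W' 1).
rewrite -/(geo (ray s 0)) -/(geo (ray 0 t)) geo_rayl// geo_rayr//.
by rewrite /geo !mxE/= !mul0r !addr0 !add0r.
Qed.

(** * The hull of the epigraph, for an abstract one-dimensional envelope [phi] *)

Section envelope.
Variables (e L U : R) (phi : R -> R).
Hypotheses (e0 : 0 < e) (L0 : 0 < L) (LU : L < U).
Hypothesis phi_convex : forall k x y : R, 0 <= k <= 1 -> 0 <= x -> 0 <= y ->
  phi (k * x + (1 - k) * y) <= k * phi x + (1 - k) * phi y.
Hypothesis phi_mono : forall x y : R, 0 <= x -> x <= y -> phi x <= phi y.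
Hypothesis phi_le : forall x, L <= x <= U -> phi x <= x `^ e.
(* Together with [phi_convex] and [phi_le]: on [L, U], phi is the convex
   envelope of the power. *)
Hypothesis phi_attained : forall x, L <= x <= U -> exists k y z : R,
  [/\ 0 <= k <= 1, L <= y <= U, L <= z <= U, x = k * y + (1 - k) * z
    & k * y `^ e + (1 - k) * z `^ e <= phi x].

Let A := epi (fun x => geo x `^ e) [set x | wedge p q x /\ L <= geo x <= U].

(** Along a boundary ray [geo] is the parameter itself, so the combination from [phi_attained] can
    be lifted to the ray. *)
Let hull_ray (r : R -> 'rV[R]_2) m z :
  (forall k x y, r (k * x + (1 - k) * y) = k *: r x + (1 - k) *: r y) ->
  (forall x, 0 <= x -> wedge p q (r x)) ->
  (forall x, 0 <= x -> geo (r x) = x) ->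
  L <= m <= U -> phi m <= z -> convex_hull A (r m, z).
Proof.
move=> rD rW rg mLU mz.
have [k [x [y [k01 xLU yLU mE le]]]] := phi_attained mLU.
(* Raising both endpoints by the same excess [d] makes the combined height exactly [z] and keeps
   them in the epigraph. *)
pose d := z - (k * x `^ e + (1 - k) * y `^ e).
have d0 : 0 <= d by rewrite subr_ge0 (le_trans le).
have -> : (r m, z) =
    k *: (r x, x `^ e + d : R^o) + (1 - k) *: (r y, y `^ e + d : R^o).
  rewrite pair_comb mE rD; congr pair; rewrite /d; ring.
have pt v : L <= v <= U -> convex_hull A (r v, v `^ e + d : R^o).
  move=> vLU; have v0 : 0 <= v by case/andP: vLU => /(le_trans (ltW L0)).
  apply: sub_gen_smallest; rewrite /A /epi/= rg//; split; last by rewrite lerDl.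
  by split; first exact: rW.
by apply: hull_comb => //; exact: pt.
Qed.

Lemma hull_epi_geo :
  convex_hull A = [set w : 'rV[R]_2 * R^o | exists s t : R,
    [/\ 0 <= s, 0 <= t & w.1 = ray s t] /\
    [/\ L <= geo w.1, s + t <= U, phi (s + t) <= w.2 & L `^ e <= w.2]].
Proof.
apply/seteqP; split.
  apply: smallest_sub; last first.
    (* The right-hand side contains the epigraph; its convexity is checked afterwards. *)
    move=> [x z] [/= [W /andP[Lx xU]] xz].
    have [s [t [s0 t0 xE]]] := wedgeP W; exists s, t; split=> //=.
    have stx : s + t <= geo x by rewrite xE geo_ray_ge.
    split=> //; first exact: le_trans xU.
      rewrite (le_trans (phi_mono _ stx)) ?addr_ge0//.
      by apply: le_trans xz; rewrite phi_le// Lx.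
    apply: le_trans xz; apply: ge0_ler_powR => //; rewrite ?nnegrE ?ltW//.
    exact: lt_le_trans Lx.
  move=> [x z] [x' z'] k; rewrite !inE/=.
  move=> [s [t [[s0 t0 ->] [Lg stU phiz Lz]]]].
  move=> [s' [t' [[s0' t0' ->] [Lg' stU' phiz' Lz']]]].
  have k01 : 0 <= k%:num <= 1 by rewrite ge0 le1.
  have /andP[k0 k1] := k01; have k1' : 0 <= 1 - k%:num by rewrite subr_ge0.
  have cmb (u v w w' : R) : u <= w -> v <= w' ->
      k%:num * u + (1 - k%:num) * v <= k%:num * w + (1 - k%:num) * w'.
    by move=> uw vw; apply: lerD; exact: ler_wpM2l.
  have cst (v : R) : v = k%:num * v + (1 - k%:num) * v by ring.
  exists (k%:num * s + (1 - k%:num) * s'), (k%:num * t + (1 - k%:num) * t').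
  rewrite ray_comb; split; first by split => //; rewrite addr_ge0 ?mulr_ge0.
  have -> : k%:num * s + (1 - k%:num) * s' + (k%:num * t + (1 - k%:num) * t') =
    k%:num * (s + t) + (1 - k%:num) * (s' + t') by ring.
  split.
  - rewrite [leLHS]cst -ray_comb; apply: le_trans (cmb _ _ _ _ Lg Lg') _.
    exact: geo_concave.
  - by rewrite [leRHS]cst; exact: cmb.
  - by rewrite (le_trans (phi_convex _ _ _))// ?addr_ge0//; exact: cmb.
  - by rewrite [leLHS]cst; exact: cmb.
move=> [x z] [s [t [[/= s0 t0 ->] [Lg stU phiz Lz]]]].
set m := s + t in stU phiz.
have [Lm|mL] := leP L m.
  have m0 : 0 < m by exact: lt_le_trans Lm.
  have mLU : L <= m <= U by rewrite Lm.
  (* The level segment of M through [ray s t] has its ends [ray m 0] and [ray 0 m] on the boundary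
     rays. *)
  have -> : (ray s t, z) = (s / m) *: (ray m 0, z : R^o)
                           + (1 - s / m) *: (ray 0 m, z : R^o).
    rewrite pair_comb; congr pair; last by ring.
    rewrite -ray_comb; congr ray; rewrite /m; field; exact: lt0r_neq0.
  apply: hull_comb.
  - by rewrite divr_ge0 ?(ltW m0)//= ler_pdivrMr// mul1r lerDl.
  - apply: (hull_ray (r := fun x => ray x 0)) => //.
    + by move=> k u v; rewrite -ray_comb !mulr0 addr0.
    + by move=> u u0; exact: wedge_ray.
    + exact: geo_rayl.
  - apply: (hull_ray (r := fun x => ray 0 x)) => //.
    + by move=> k u v; rewrite -ray_comb !mulr0 addr0.
    + by move=> u u0; exact: wedge_ray.
    + exact: geo_rayr.
(* The line from the point of the lower ray where geo = L through x leaves the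
   wedge at a point where geo < L, so it meets the curve geo = L beyond x. *)
have sL : s < L by apply: le_lt_trans mL; rewrite lerDl.
have tp : 0 < t.
  rewrite lt_neqAle t0 andbT; apply: contraTneq sL => tE.
  by move: Lg; rewrite -tE geo_rayl// -leNgt.
(* [r] is the parameter of [ray s t] on the segment from [ray 0 c] (parameter 0) to [ray L 0]
   (parameter 1). *)
pose r := s / L; have r01 : 0 <= r < 1.
  by rewrite divr_ge0 ?(ltW L0)//= ltr_pdivrMr// mul1r.
have /andP[r0 r1] := r01; have r1' : 0 < 1 - r by rewrite subr_gt0.
pose c := t / (1 - r); have c0 : 0 < c by rewrite divr_gt0.
have rL : r * L = s by rewrite divfK// gt_eqF.
have cE : (1 - r) * c = t by rewrite mulrC divfK// gt_eqF.
(* This amounts to [s + t <= L]; it puts the end [ray 0 c] at or below the level [L], as the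
   intermediate value argument requires. *)
have cL : c <= L.
  rewrite ler_pdivrMr// mulrBr mulr1 /r mulrCA mulfV ?gt_eqF// mulr1.
  by rewrite lerBrDl ltW.
clearbody c; have [W _] := wedge_ray (ltW L0) (lexx 0).
have rayc : ray s t = ray (r * L + (1 - r) * 0) (r * 0 + (1 - r) * c).
  by congr ray; rewrite ?rL ?cE !mulr0 ?addr0 ?add0r.
have cpos i : 0 < ray 0 c 0 i.
  rewrite !mxE !mul0r !add0r.
  have cq : 0 < c / q `^ b by rewrite divr_gt0 ?powR_gt0.
  by case: ifP => _ //; exact: mulr_gt0.
have geoE k : geo (ray (k * L + (1 - k) * 0) (k * 0 + (1 - k) * c)) =
    (k * ray L 0 0 0 + (1 - k) * ray 0 c 0 0) `^ a *
    (k * ray L 0 0 1 + (1 - k) * ray 0 c 0 1) `^ b.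
  by rewrite ray_comb /geo !mxE.
have := @powR2_IVT _ a b L r _ _ _ _ r01 L0 (W 0) (W 1) (cpos 0) (cpos 1).
move=> /=; rewrite -!geoE -rayc Lg andbT.
rewrite !mul0r subr0 !mul1r !add0r geo_rayr ?(ltW c0)// cL.
move=> /(_ isT)[k /andP[k0 kr]]; rewrite -geoE => gk.
have k1 : 0 < 1 - k by rewrite subr_gt0 (le_lt_trans kr).
have ptL x' : wedge p q x' -> geo x' = L -> convex_hull A (x', z : R^o).
  move=> W' gx; apply: sub_gen_smallest; rewrite /A /epi/= gx; split => //.
  by rewrite lexx ltW.
(* With [k <= r < 1], the point of parameter [r] lies between those of parameters [k] and 1; the
   weight solves [r = w + (1 - w) * k]. *)
have -> : (ray s t, z) = ((r - k) / (1 - k)) *: (ray L 0, z : R^o) +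
    (1 - (r - k) / (1 - k)) *:
    (ray (k * L + (1 - k) * 0) (k * 0 + (1 - k) * c), z : R^o).
  rewrite pair_comb; congr pair; last by ring.
  by rewrite rayc -ray_comb; congr ray; field; rewrite gt_eqF.
apply: hull_comb.
- by rewrite divr_ge0 ?(ltW k1) ?subr_ge0//= ler_pdivrMr// mul1r lerD2r ltW.
- by apply: ptL; [apply: wedge_ray => //; exact: ltW|rewrite geo_rayl// ltW].
- by apply: ptL => //; apply: wedge_ray;
    rewrite addr_ge0 ?mulr_ge0 ?(ltW L0) ?(ltW c0) ?(ltW k1).
Qed.

End envelope.
End wedge_rays.

(** * Roots of inequalities and closed forms of the constants *)

Lemma powR_ler_root (R : realType) (e x y : R) :
  0 < e -> 0 <= x -> 0 <= y -> (x <= y `^ e) = (x `^ e^-1 <= y).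
Proof.
move=> e0 x0 y0; have ie0 : 0 < e^-1 by rewrite invr_gt0.
apply/idP/idP => [/(ge0_ler_powR (ltW ie0))|/(ge0_ler_powR (ltW e0))];
  rewrite -powRrM ?mulfV ?mulVf ?gt_eqF// powRr1//; apply;
  by rewrite nnegrE ?powR_ge0.
Qed.

Lemma powR_root_ler (R : realType) (e x y : R) :
  0 < e -> 0 <= x -> 0 <= y -> (y `^ e <= x) = (y <= x `^ e^-1).
Proof.
move=> e0 x0 y0.
by rewrite [RHS]powR_ler_root ?invr_gt0// invrK.
Qed.

Section constants.
Context {R : realType}.
Variables a1 a2 p q l u : R.
Hypotheses (a1_gt0 : 0 < a1) (a2_gt0 : 0 < a2).
Hypotheses (p_gt0 : 0 < p) (p_lt_q : p < q).
Hypotheses (l_gt0 : 0 < l) (l_lt_u : l < u).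

Let beta := a1 + a2.
Let a := a1 / beta.
Let b := a2 / beta.
Let L := l `^ beta^-1.
Let U := u `^ beta^-1.

Let beta0 : 0 < beta. Proof. exact: addr_gt0. Qed.
Let a0 : 0 < a. Proof. exact: divr_gt0. Qed.
Let b0 : 0 < b. Proof. exact: divr_gt0. Qed.
Let ab : a + b = 1. Proof. by rewrite -mulrDl divff// gt_eqF. Qed.
Let q_gt0 : 0 < q. Proof. exact: lt_trans p_lt_q. Qed.
Let pb0 : 0 < p `^ b. Proof. exact: powR_gt0. Qed.
Let qb0 : 0 < q `^ b. Proof. exact: powR_gt0. Qed.
Let qp0 : 0 < q - p. Proof. by rewrite subr_gt0. Qed.
Let u_gt0 : 0 < u. Proof. exact: lt_trans l_lt_u. Qed.
Let L0 : 0 < L. Proof. exact: powR_gt0. Qed.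
Let LU : L < U.
Proof. by apply: gt0_ltr_powR; rewrite ?invr_gt0 ?nnegrE ?ltW. Qed.
Let Lbeta : L `^ beta = l.
Proof. by rewrite -powRrM mulVf ?gt_eqF// powRr1 ?ltW. Qed.
Let Ubeta : U `^ beta = u.
Proof. by rewrite -powRrM mulVf ?gt_eqF// powRr1 ?ltW. Qed.

(** The closed form of [lambda^(1/beta)], hence the factor that turns [d2 x1 - d1 x2] into M. *)
Let kappa := p `^ b * q `^ b / (q - p).
Let kappa0 : 0 < kappa. Proof. by rewrite divr_gt0 ?mulr_gt0. Qed.

Let powR_a (r : R) : 0 < r -> r `^ a = r / r `^ b.
Proof.
move=> r0; rewrite -[X in X / _]powRr1 ?ltW// -ab powRD ?ab ?oner_eq0//.
by rewrite mulfK// gt_eqF// powR_gt0.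
Qed.

Lemma d1E : d1 a1 a2 p q = (q `^ b)^-1 - (p `^ b)^-1.
Proof. by rewrite /d1 mulNr !powRN. Qed.

Lemma d2E : d2 a1 a2 p q = q / q `^ b - p / p `^ b.
Proof. by rewrite /d2 !powR_a. Qed.

Lemma lambdaE : lambda a1 a2 p q = kappa `^ beta.
Proof.
rewrite /lambda (_ : _ - _ = (q - p) / q `^ b); last first.
  by rewrite d1E d2E; field; rewrite !gt_eqF.
apply: (mulIf (x := ((q - p) / q `^ b) `^ beta)).
  by rewrite gt_eqF// powR_gt0// divr_gt0.
rewrite divfK; last by rewrite gt_eqF// powR_gt0// divr_gt0.
rewrite -powRM ?divr_ge0 ?mulr_ge0 ?ltW//.
rewrite (_ : kappa * _ = p `^ b); last by rewrite /kappa; field; rewrite !gt_eqF.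
by rewrite -powRrM divfK// gt_eqF.
Qed.

Lemma lambda_root : lambda a1 a2 p q `^ beta^-1 = kappa.
Proof. by rewrite lambdaE -powRrM mulfV ?gt_eqF// powRr1 ?ltW. Qed.

Lemma u_div_lambda : (u / lambda a1 a2 p q) `^ beta^-1 = U / kappa.
Proof.
apply: (mulIf (x := kappa)); first by rewrite gt_eqF.
rewrite divfK ?gt_eqF// -[in LHS]lambda_root -powRM ?divfK//.
- by rewrite lambdaE gt_eqF// powR_gt0.
- by rewrite lambdaE divr_ge0 ?powR_ge0// ltW.
- by rewrite lambdaE powR_ge0.
Qed.

(** The form takes the same value [kappa^-1] on the generators of both boundary rays. *)
Lemma linear_form_ray (s t : R) :
  d2 a1 a2 p q * ray b p q s t 0 0 - d1 a1 a2 p q * ray b p q s t 0 1 =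
  (s + t) / kappa.
Proof.
rewrite d1E d2E !mxE/= /kappa; field.
by rewrite !gt_eqF.
Qed.

Lemma monomial_geo x : orthant x -> monomial a1 a2 x = geo a b x `^ beta.
Proof.
move=> x0; rewrite /geo powRM ?powR_ge0// -!powRrM.
by rewrite !divfK ?gt_eqF.
Qed.

Lemma monomial_level x : orthant x ->
  (l <= monomial a1 a2 x <= u) = (L <= geo a b x <= U).
Proof.
move=> x0; have g0 : 0 <= geo a b x by rewrite mulr_ge0 ?powR_ge0.
rewrite monomial_geo//; congr andb.
- by apply: powR_ler_root => //; exact: ltW.
- by apply: powR_root_ler => //; exact: ltW.
Qed.

(** Transports [hull_epi_geo] to the original data by taking roots of order [beta]; each case of the
    theorem then only has to supply [phi]. *)
Lemma lower_envelope_wedge (phi : R -> R) (fl : 'rV[R]_2 -> R) :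
  (forall k x y : R, 0 <= k <= 1 -> 0 <= x -> 0 <= y ->
    phi (k * x + (1 - k) * y) <= k * phi x + (1 - k) * phi y) ->
  (forall x y : R, 0 <= x -> x <= y -> phi x <= phi y) ->
  (forall x, L <= x <= U -> phi x <= x `^ beta) ->
  (forall x, L <= x <= U -> exists k y z : R,
    [/\ 0 <= k <= 1, L <= y <= U, L <= z <= U, x = k * y + (1 - k) * z
      & k * y `^ beta + (1 - k) * z `^ beta <= phi x]) ->
  (forall s t : R, 0 <= s -> 0 <= t -> fl (ray b p q s t) = phi (s + t)) ->
  lower_envelope (monomial a1 a2) (levelX a1 a2 l u `&` wedge p q) =
  [set w : 'rV[R]_2 * R^o |
    [/\ regionY a1 a2 p q l u w.1, fl w.1 <= w.2 & l <= w.2]].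
Proof.
move=> phic phim phile phia flE.
have geo0 x : 0 <= geo a b x by rewrite mulr_ge0 ?powR_ge0.
have -> : lower_envelope (monomial a1 a2) (levelX a1 a2 l u `&` wedge p q) =
    convex_hull (epi (fun x => geo a b x `^ beta)
                     [set x | wedge p q x /\ L <= geo a b x <= U]).
  congr convex_hull; apply/seteqP; split=> -[x z] /=.
  - move=> [[[x0 lxu] W] xz]; rewrite /epi/= -monomial_geo//.
    by split => //; split; rewrite // -monomial_level.
  - move=> [[W lxu] xz]; have [x0 _] := W; rewrite /epi/= monomial_geo//.
    by do 2?split => //; split => //; rewrite monomial_level.
rewrite (@hull_epi_geo _ _ _ _ _ a0 b0 ab p_gt0 p_lt_q beta L U phi)// Lbeta.
apply/seteqP; split=> -[x z] /=.
- move=> [s [t [[s0 t0 ->] [Lg stU phiz lz]]]].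
  have W := wedge_ray b p_gt0 p_lt_q s0 t0; have [x0 xpq] := W.
  rewrite flE//; split=> //; split=> //.
  + by rewrite -/(monomial a1 a2 _) monomial_geo// powR_ler_root// ltW.
  + by rewrite linear_form_ray ler_pdivrMr// u_div_lambda divfK// gt_eqF.
- move=> [[x0 xpq lx xu] flz lz].
  have [s [t [s0 t0 xE]]] : exists s t, [/\ 0 <= s, 0 <= t & x = ray b p q s t].
    by apply: wedgeP.
  exists s, t; split => //; rewrite -flE// -xE; split => //.
  + by rewrite -powR_ler_root ?(ltW l_gt0)// -monomial_geo.
  + by move: xu; rewrite xE linear_form_ray ler_pdivrMr// u_div_lambda divfK// gt_eqF.
Qed.

(** * The convex and the concave power *)

Lemma lower_envelope_ge1 : 1 <= a1 + a2 ->
  lower_envelope (monomial a1 a2) (levelX a1 a2 l u `&` wedge p q) =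
  [set w : 'rV[R]_2 * R^o |
    [/\ regionY a1 a2 p q l u w.1, fl_ge1 a1 a2 p q w.1 <= w.2 & l <= w.2]].
Proof.
move=> beta1; apply: (@lower_envelope_wedge (fun x => x `^ beta)).
- by move=> k x y; exact: powR_convex.
- move=> x y x0 xy; apply: ge0_ler_powR; rewrite ?nnegrE ?(ltW beta0)//.
  exact: le_trans xy.
- by [].
(* The convex power is its own envelope, so a trivial combination suffices. *)
- move=> x xLU; exists 1, x, x.
  by rewrite subrr !mul1r !mul0r !addr0; split; rewrite ?lexx ?ler01.
- move=> s t s0 t0; rewrite /fl_ge1 linear_form_ray lambdaE -/beta -powRM.
  + by rewrite mulrC divfK// gt_eqF.
  + exact: ltW.
  + by rewrite divr_ge0 ?addr_ge0// ltW.
Qed.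

Lemma lower_envelope_le1 : a1 + a2 <= 1 ->
  lower_envelope (monomial a1 a2) (levelX a1 a2 l u `&` wedge p q) =
  [set w : 'rV[R]_2 * R^o |
    [/\ regionY a1 a2 p q l u w.1, fl_le1 a1 a2 p q l u w.1 <= w.2 & l <= w.2]].
Proof.
move=> beta1; have UL0 : 0 < U - L by rewrite subr_gt0.
(* The line through [(L, l)] and [(U, u)], two points of the graph of the power; its value at 0 is
   [z0] and its slope is [zeta / kappa]. *)
pose chord x := l + (u - l) / (U - L) * (x - L).
have slope0 : 0 <= (u - l) / (U - L).
  by rewrite divr_ge0 ?(ltW UL0)// subr_ge0 ltW.
have chordE x : L <= x <= U -> exists k, [/\ 0 <= k <= 1,
    x = k * L + (1 - k) * U & k * l + (1 - k) * u = chord x].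
  move=> /andP[Lx xU]; exists ((U - x) / (U - L)); split.
  - by rewrite divr_ge0 ?subr_ge0 ?(ltW LU)//= ler_pdivrMr// mul1r lerD2l lerN2.
  - by field; rewrite gt_eqF.
  - by rewrite /chord; field; rewrite gt_eqF.
apply: (@lower_envelope_wedge chord).
- by move=> k x y _ _ _; rewrite le_eqVlt; apply/orP; left; rewrite /chord;
    apply/eqP; ring.
- by move=> x y _ xy; rewrite lerD2l ler_wpM2l// lerD2r.
(* A concave power lies above its chord. *)
- move=> x /chordE[k [k01 -> <-]]; rewrite -[in leLHS]Lbeta -[in leLHS]Ubeta.
  by apply: powR_concave; rewrite ?beta0// ltW// (lt_trans L0).
- move=> x /chordE[k [k01 xE kE]]; exists k, L, U.
  by rewrite Lbeta Ubeta kE !lexx (ltW LU).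
- move=> s t s0 t0; rewrite /fl_le1 linear_form_ray /zeta /z0 lambda_root /chord.
  rewrite -/beta -/L -/U; field.
  by rewrite !gt_eqF.
Qed.

End constants.

Theorem theorem2 (R : realType) (a1 a2 p q l u : R)
    (a1_gt0 : 0 < a1) (a2_gt0 : 0 < a2)
    (p_gt0 : 0 < p) (p_lt_q : p < q)
    (l_gt0 : 0 < l) (l_lt_u : l < u) :
  (1 <= a1 + a2 ->
     lower_envelope (monomial a1 a2) (levelX a1 a2 l u `&` wedge p q) =
     [set w : 'rV[R]_2 * R^o |
       [/\ regionY a1 a2 p q l u w.1, fl_ge1 a1 a2 p q w.1 <= w.2 & l <= w.2]])
  /\
  (a1 + a2 <= 1 ->
     lower_envelope (monomial a1 a2) (levelX a1 a2 l u `&` wedge p q) =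
     [set w : 'rV[R]_2 * R^o |
       [/\ regionY a1 a2 p q l u w.1, fl_le1 a1 a2 p q l u w.1 <= w.2 & l <= w.2]]).
Proof.
by split; [exact: lower_envelope_ge1|exact: lower_envelope_le1].
Qed.
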